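(* Let $p\ge 2$, $m\ge 1$, $d\ge1$, $n\ge1$. Let $\sigma:\mathbb{R}\to\mathbb{R}$ be one of: (a) a piecewise-polynomial activation with at most $L\ge1$ pieces and maximal piece degree $r\ge1$; (b) a trigonometric polynomial of degree at most $K$; (c) a polynomial–rational–exponential activation. Let $\mathcal{H}_\sigma=\{h_\theta:\ \theta=(W,V)\in\mathbb{R}^{d\times p}\times\mathbb{R}^{p\times d}\}$ where $h_\theta$ is the predictor induced by the scores $s^\theta(x)=V\sigma(Wx)$. Then for every $\delta\in(0,1)$, with probability at least $1-\delta$ over the draw of $\mathcal{D}_{\mathrm{train}}=\{(x^{(i)},y^{(i)})\}_{i=1}^n\sim\mathcal{D}_m^n$, \[ \sup_{h\in\mathcal{H}_\sigma}\Big|\mathbb{P}_{(X,Y)\sim\mathcal{D}_m}[h(X)\ne Y]-\frac1n\sum_{i=1}^n\mathbf{1}\{h(x^{(i)})\ne y^{(i)}\}\Big|\ \le\ \widetilde{\mathcal{O}}\!\left(\sqrt{\frac{dp+\log(1/\delta)}{n}}\right). \]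
   Context: Let $[p]=\{0,\dots,p-1\}$, $e_r$ the standard basis of $\mathbb{R}^p$, $\mathcal{X}_m=\{x\in\{0,\dots,m\}^p:\|x\|_1=m\}$. $\mathcal{D}_m$ is the law of $(X,Y)$ with $s_1,\dots,s_m$ i.i.d. uniform on $[p]$, $X=\sum_i e_{s_i}$, $Y=(\sum_i s_i)\bmod p$; $\mathcal{D}_m^n$ denotes $n$ i.i.d. draws. $\sigma$ is applied entrywise. The predictor is $h_\theta(x)=\ell$ if $s^\theta_\ell(x)>s^\theta_k(x)$ for all $k\ne\ell$, and $h_\theta(x)=\bot$ (counted as an error) otherwise. Activation families: (a) piecewise polynomial: there are breakpoints $-\infty=b_0<b_1<\dots<b_L=+\infty$ and polynomials $P_1,\dots,P_L$ of degree $\le r$ with $\sigma(t)=P_\ell(t)$ on $(b_{\ell-1},b_\ell]$; (b) trigonometric polynomial: $\sigma(t)=a_0+\sum_{k=1}^K(a_k\cos(kt)+b_k\sin(kt))$ with real coefficients; (c) polynomial–rational–exponential: $\sigma(t)=P(t)\frac{ae^{kt}+b}{ce^{kt}+\tau}$ with fixed $k\in\mathbb{R}\setminus\{0\}$, $c\ge0$, $\tau>0$, $a,b\in\mathbb{R}$ and a real polynomial $P$. Notation: $f=\widetilde{\mathcal{O}}(g)$ means $f\le C\cdot g$ up to an absolute constant (independent of the architecture and data, but allowed to depend on the fixed activation) and polylogarithmic factors (in the problem parameters $d,p,m,n,1/\delta$). *)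

(* Defs.v *)
From HB Require Import structures.
From mathcomp Require Import all_boot all_order all_algebra.
From mathcomp Require Import boolp reals sequences exp trigo.
Set Implicit Arguments. Unset Strict Implicit. Unset Printing Implicit Defensive.
Import Order.TTheory GRing.Theory Num.Theory.
Local Open Scope ring_scope.

Section Defs.
Variable R : realType.

(* (a) piecewise polynomial with L pieces of degree <= r:
   interior breakpoints b_1 < ... < b_{L-1} (the seq b, b_0 = -oo, b_L = +oo),
   polynomials P_1..P_L (the seq P), sigma = P_l on (b_{l-1}, b_l]. *)
Definition piecewise_poly_act (sigma : R -> R) (L r : nat) : Prop :=
  exists (b : seq R) (P : seq {poly R}),
    [/\ size b = L.-1, sorted <%R b, size P = L,
        (forall l, (l < L)%N -> (size (nth 0%R P l) <= r.+1)%N) &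
        forall (t : R) (l : nat), (l < L)%N ->
          (l == 0%N) || (nth 0 b l.-1 < t) ->
          (l == L.-1) || (t <= nth 0 b l) ->
          sigma t = (nth 0 P l).[t]].

Definition trig_poly_act (sigma : R -> R) (K : nat) : Prop :=
  exists (a0 : R) (a bb : nat -> R),
    forall t : R, sigma t =
      a0 + \sum_(1 <= k < K.+1) (a k * cos (k%:R * t) + bb k * sin (k%:R * t)).

Definition pre_act (sigma : R -> R) : Prop :=
  exists (k c tau a bb : R) (P : {poly R}),
    [/\ k != 0, 0 <= c, 0 < tau &
        forall t : R, sigma t =
          P.[t] * ((a * expR (k * t) + bb) / (c * expR (k * t) + tau))].

Definition activation_family (sigma : R -> R) : Prop :=
  (exists L r : nat, [/\ (1 <= L)%N, (1 <= r)%N & piecewise_poly_act sigma L r])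
  \/ (exists K : nat, trig_poly_act sigma K)
  \/ pre_act sigma.

Definition featX (p m : nat) (s : {ffun 'I_m -> 'I_p}) : 'cV[R]_p :=
  \sum_(i < m) delta_mx (s i) ord0.
Definition labelY (p m : nat) (s : {ffun 'I_m -> 'I_p}) : nat :=
  (\sum_(i < m) (s i : nat)) %% p.

Definition scores (sigma : R -> R) (d p : nat) (W : 'M[R]_(d, p)) (V : 'M[R]_(p, d))
  (x : 'cV[R]_p) : 'cV[R]_p := V *m map_mx sigma (W *m x).

Definition predictor (sigma : R -> R) (d p : nat) (W : 'M[R]_(d, p)) (V : 'M[R]_(p, d))
  (x : 'cV[R]_p) : option 'I_p :=
  [pick l : 'I_p | [forall k : 'I_p,
      (k != l) ==> (scores sigma W V x k ord0 < scores sigma W V x l ord0)]].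

Definition err01 (sigma : R -> R) (d p m : nat) (W : 'M[R]_(d, p)) (V : 'M[R]_(p, d))
  (s : {ffun 'I_m -> 'I_p}) : R :=
  if omap (@nat_of_ord p) (predictor sigma W V (featX s)) == Some (labelY s)
  then 0 else 1.

(* P_{(X,Y) ~ D_m}[h(X) <> Y]: s uniform on [p]^m *)
Definition pop_risk (sigma : R -> R) (d p m : nat) (W : 'M[R]_(d, p)) (V : 'M[R]_(p, d))
  : R :=
  (#|{: {ffun 'I_m -> 'I_p}}|%:R)^-1 * \sum_(s : {ffun 'I_m -> 'I_p}) err01 sigma W V s.

Definition emp_risk (sigma : R -> R) (d p m n : nat) (W : 'M[R]_(d, p)) (V : 'M[R]_(p, d))
  (S : {ffun 'I_n -> {ffun 'I_m -> 'I_p}}) : R :=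
  (n%:R)^-1 * \sum_(i < n) err01 sigma W V (S i).

(* probability of an event under D_m^n: n i.i.d. uniform draws of s^(i) in [p]^m,
   i.e. the uniform distribution on ([p]^m)^n *)
Definition prob_train (p m n : nat) (E : {ffun 'I_n -> {ffun 'I_m -> 'I_p}} -> Prop) : R :=
  #|[set S | `[< E S >] ]|%:R / #|{: {ffun 'I_n -> {ffun 'I_m -> 'I_p}}}|%:R.

End Defs.

(* Main.v *)
Require Import Defs.
From HB Require Import structures.
From mathcomp Require Import all_boot all_order all_algebra.
From mathcomp Require Import ring lra zify.
From mathcomp Require Import boolp classical_sets functions reals topology.
From mathcomp Require Import normedtype sequences derive exp trigo.
Set Implicit Arguments. Unset Strict Implicit. Unset Printing Implicit Defensive.
Import Order.TTheory GRing.Theory Num.Theory.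
Import numFieldNormedType.Exports.
Local Open Scope ring_scope.

(** Uniform convergence over a finite sample space follows from a bound on the
    number of error patterns on [2n] points, by symmetrization and a union bound
    (with exponential moments in place of a tail bound for the ghost sample).

    The inputs are vectors of nonnegative integers of size [m], so the scores are
    quotients of polynomials in [O(dp)] quantities ([w], [cos w], [sin w],
    [exp (k w)] for the individual weights), up to the choice of a polynomial
    piece, itself decided by signs of such polynomials. Hence it suffices to bound
    the number of sign patterns of [N] polynomials of degree [D] in [q] variables
    by [(2 N D + 1)^q].

    For this, let [F] be the product of the squares of the polynomials, of degree
    [E = 2 N D], made nonzero at one witness per pattern by a small shift. For small
    [lam > 0], the function [lam * sum x_i^(E+2) - F] is negative at the witnesses,
    so each pattern yields a critical point. The critical points satisfy
    [x_i^(E+1) = h_i(x)] with [deg h_i <= E]; modulo these equations every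
    polynomial reduces to monomials with exponents at most [E], and interpolation
    shows that there are at most [(E+1)^q] such points. *)

(** * Polynomial functions and their common zeros *)

Section PolynomialFunctions.
Variable R : realType.

(** Polynomials are kept as functions, and the last constructor makes the index an upper bound on
    the degree. Induction on a derivation replaces induction on monomials. *)
Inductive polyfun (I : Type) : nat -> ((I -> R) -> R) -> Prop :=
| polyfun_cst c : polyfun 0 (fun=> c)
| polyfun_var i : polyfun 1 (fun x => x i)
| polyfun_add k f g :
    polyfun k f -> polyfun k g -> polyfun k (fun x => f x + g x)
| polyfun_mul k l f g :
    polyfun k f -> polyfun l g -> polyfun (k + l) (fun x => f x * g x)
| polyfun_le k l f : (k <= l)%N -> polyfun k f -> polyfun l f.

Arguments polyfun_cst {I} c.
Arguments polyfun_var {I} i.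

Lemma polyfunC (I : Type) k c : polyfun k (fun _ : I -> R => c).
Proof. exact: (polyfun_le (leq0n k) (polyfun_cst c)). Qed.

Lemma polyfunZ (I : Type) k c (f : (I -> R) -> R) :
  polyfun k f -> polyfun k (fun x => c * f x).
Proof. by move=> fP; apply: (polyfun_mul (polyfun_cst c) fP). Qed.

Lemma polyfunB (I : Type) k (f g : (I -> R) -> R) :
  polyfun k f -> polyfun k g -> polyfun k (fun x => f x - g x).
Proof.
move=> fP gP; suff -> : (fun x => f x - g x) = (fun x => f x + -1 * g x).
  by apply: polyfun_add => //; apply: polyfunZ.
by apply/funext => x; rewrite mulN1r.
Qed.

Lemma polyfunX (I : Type) k n (f : (I -> R) -> R) :
  polyfun k f -> polyfun (n * k) (fun x => f x ^+ n).
Proof.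
move=> fP; elim: n => [|n IHn]; first exact: polyfunC.
suff -> : (fun x => f x ^+ n.+1) = (fun x => f x * f x ^+ n).
  by rewrite mulSn; apply: polyfun_mul.
by apply/funext => x; rewrite exprS.
Qed.

Lemma polyfun_sum (I T : Type) k (s : seq T) (P : pred T)
    (f : T -> (I -> R) -> R) :
  (forall t, P t -> polyfun k (f t)) ->
  polyfun k (fun x => \sum_(t <- s | P t) f t x).
Proof.
move=> fP; elim: s => [|t s IHs].
  rewrite (_ : (fun _ => _) = (fun=> 0)); first exact: polyfunC.
  by apply/funext => x; rewrite big_nil.
case Pt : (P t); last first.
  rewrite (_ : (fun _ => _) = (fun x => \sum_(j <- s | P j) f j x)) //.
  by apply/funext => x; rewrite big_cons Pt.
rewrite (_ : (fun _ => _) = (fun x => f t x + \sum_(j <- s | P j) f j x)).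
  by apply: polyfun_add => //; apply: fP.
by apply/funext => x; rewrite big_cons Pt.
Qed.

Lemma polyfun_prod_seq (I T : Type) (k : T -> nat) (s : seq T) (P : pred T)
    (f : T -> (I -> R) -> R) :
  (forall t, P t -> polyfun (k t) (f t)) ->
  polyfun (\sum_(t <- s | P t) k t) (fun x => \prod_(t <- s | P t) f t x).
Proof.
move=> fP; elim: s => [|t s IHs].
  rewrite (_ : (fun _ => _) = (fun=> 1)); first exact: polyfunC.
  by apply/funext => x; rewrite big_nil.
rewrite big_cons; case Pt : (P t); last first.
  rewrite (_ : (fun _ => _) = (fun x => \prod_(j <- s | P j) f j x)) //.
  by apply/funext => x; rewrite big_cons Pt.
rewrite (_ : (fun _ => _) = (fun x => f t x * \prod_(j <- s | P j) f j x)).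
  by apply: polyfun_mul => //; apply: fP.
by apply/funext => x; rewrite big_cons Pt.
Qed.

Lemma polyfun_prod (I : Type) (T : finType) k (P : pred T)
    (f : T -> (I -> R) -> R) :
  (forall t, P t -> polyfun k (f t)) ->
  polyfun (#|T| * k) (fun x => \prod_(t | P t) f t x).
Proof.
move=> /polyfun_prod_seq-/(_ (index_enum T)); apply: polyfun_le.
by rewrite sum_nat_const leq_mul2r max_card orbT.
Qed.

Lemma polyfun_reindex (I J : Type) (h : J -> I) k (f : (J -> R) -> R) :
  polyfun k f -> polyfun k (fun x => f (x \o h)).
Proof.
elim=> {k f} [c|i|k f g _ IHf _ IHg|k l f g _ IHf _ IHg|k l f kl _ IHf].
- exact: polyfun_cst.
- exact: (polyfun_var (h i)).
- exact: polyfun_add.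
- exact: polyfun_mul.
- exact: polyfun_le IHf.
Qed.

Lemma polyfun_horner (I : Type) k (p : {poly R}) (f : (I -> R) -> R) :
  polyfun k f -> polyfun ((size p).-1 * k) (fun x => p.[f x]).
Proof.
move=> fP; rewrite (_ : (fun x => p.[f x]) =
    (fun x => \sum_(i < size p) p`_i * f x ^+ i)); last first.
  by apply/funext => x; rewrite horner_coef.
apply: polyfun_sum => i _; apply: polyfunZ.
apply: polyfun_le (polyfunX i fP); rewrite leq_mul2r.
by rewrite -ltnS (leq_trans (ltn_ord i)) ?orbT// leqSpred.
Qed.

Lemma polyfun_bound (I : Type) k (f : (I -> R) -> R) : polyfun k f ->
  exists2 C : R, 0 <= C & forall (x : I -> R) r, 1 <= r ->
    (forall i, `|x i| <= r) -> `|f x| <= C * r ^+ k.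
Proof.
elim=> {k f}
  [c|i|k f g _ [A A0 HA] _ [B B0 HB]|k l f g _ [A A0 HA] _ [B B0 HB]|
   k l f kl _ [A A0 HA]].
- by exists `|c| => // x r r1 _; rewrite expr0 mulr1.
- by exists 1 => // x r r1 xr; rewrite mul1r expr1.
- exists (A + B) => [|x r r1 xr]; first exact: addr_ge0.
  by rewrite mulrDl (le_trans (ler_normD _ _))// lerD ?HA ?HB.
- exists (A * B) => [|x r r1 xr]; first exact: mulr_ge0.
  by rewrite normrM exprD mulrACA ler_pM// ?HA ?HB.
- exists A => // x r r1 xr; apply: le_trans (HA x r r1 xr) _.
  by rewrite ler_wpM2l// ler_weXn2l.
Qed.

Lemma polyfun_continuous (T : topologicalType) (I : Type) k
    (f : (I -> R) -> R) (h : T -> I -> R) :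
  (forall i, continuous (h^~ i)) -> polyfun k f -> continuous (f \o h).
Proof.
move=> hc; elim=> {k f} [c|i|k f g _ IHf _ IHg|k l f g _ IHf _ IHg|//].
- exact: cst_continuous.
- exact: hc.
- by move=> x; apply: (@continuousD _ _ _ (f \o h) (g \o h)); [exact: IHf|exact: IHg].
- by move=> x; apply: (@continuousM _ _ (f \o h) (g \o h)); [exact: IHf|exact: IHg].
Qed.

Definition upd (I : eqType) (x : I -> R) i t : I -> R :=
  fun j => if j == i then t else x j.

(** The degree-zero clause supports the product rule: for constant [g], the term [f * g'] would have
    degree [k] instead of [k.-1] unless [g'] vanishes. *)
Lemma polyfun_partial (I : eqType) (i : I) k (f : (I -> R) -> R) :
  polyfun k f -> exists g, [/\ polyfun k.-1 g, k = 0%N -> g = fun=> 0 &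
    forall x t, is_derive t (1 : R) (fun t => f (upd x i t))
                          (g (upd x i t))].
Proof.
elim=> {k f} [c|j|k f g _ [f' [f'P f'0 df]] gP [g' [g'P g'0 dg]]|
  k l f g fP [f' [f'P f'0 df]] gP [g' [g'P g'0 dg]]|
  k l f kl _ [f' [f'P f'0 df]]].
- by exists (fun=> 0); split=> // [|x t]; [exact: polyfunC|exact: is_derive_cst].
- exists (fun=> (j == i)%:R); split=> // [|x t]; first exact: polyfunC.
  by rewrite /upd; case: (j == i); [exact: is_derive_id|exact: is_derive_cst].
- exists (fun x => f' x + g' x); split=> [|k0|x t].
  + exact: polyfun_add.
  + by rewrite f'0// g'0//; apply/funext => x; rewrite addr0.
  + exact: is_deriveD.
- exists (fun x => f x * g' x + g x * f' x); split=> [|/eqP|x t].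
  + apply: polyfun_add.
      case: l gP g'P g'0 {dg} => [|l] gP g'P g'0.
        rewrite g'0//= (_ : (fun _ => _) = fun=> 0); first exact: polyfunC.
        by apply/funext => x; rewrite mulr0.
      by rewrite addnS /=; exact: polyfun_mul.
    case: k fP f'P f'0 {df} => [|k] fP f'P f'0.
      rewrite f'0//= (_ : (fun _ => _) = fun=> 0); first exact: polyfunC.
      by apply/funext => x; rewrite mulr0.
    by rewrite addSn /= addnC; exact: polyfun_mul.
  + rewrite addn_eq0 => /andP[/eqP k0 /eqP l0]; rewrite f'0// g'0//.
    by apply/funext => x; rewrite !mulr0 addr0.
  + exact: is_deriveM.
- exists f'; split=> // [|l0]; first by apply: polyfun_le f'P; lia.
  by apply: f'0; lia.
Qed.

(** Monomials are words with repetitions, so that multiplying two of them is concatenation. *)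
Lemma polyfun_words (I : eqType) k (f : (I -> R) -> R) : polyfun k f ->
  exists s : seq (R * seq I), all (fun t => size t.2 <= k)%N s /\
    forall x, f x = \sum_(t <- s) t.1 * \prod_(i <- t.2) x i.
Proof.
elim=> {k f} [c|i|k f g _ [s [sk Hs]] _ [t [tk Ht]]|
   k l f g _ [s [sk Hs]] _ [t [tk Ht]]| k l f kl _ [s [sk Hs]]].
- by exists [:: (c, [::])]; split=> // x; rewrite big_seq1 big_nil mulr1.
- by exists [:: (1, [:: i])]; split=> // x; rewrite !big_seq1 mul1r.
- exists (s ++ t); split=> [|x]; first by rewrite all_cat sk.
  by rewrite big_cat Hs Ht.
- exists [seq (a.1 * b.1, a.2 ++ b.2) | a <- s, b <- t]; split=> [|x].
    apply/allP => _ /allpairsP[[a b] /= [sa tb ->]] /=.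
    by rewrite size_cat leq_add// ?(allP sk)// ?(allP tk).
  rewrite Hs Ht big_allpairs_dep big_distrl; apply: eq_bigr => a _ /=.
  rewrite big_distrr; apply: eq_bigr => b _ /=.
  by rewrite big_cat /= mulrACA.
- exists s; split=> //; apply: sub_all sk => t /leq_trans; exact.
Qed.

Lemma prod_word_count (I : finType) (w : seq I) (x : I -> R) :
  \prod_(i <- w) x i = \prod_i x i ^+ count_mem i w.
Proof.
elim: w => [|j w IHw].
  by rewrite big_nil big1// => i _; rewrite expr0.
rewrite big_cons; under [RHS]eq_bigr do rewrite /= exprD.
rewrite big_split IHw /=; congr (_ * _).
rewrite (bigD1 j)//= eqxx expr1 big1 ?mulr1// => i ij.
by rewrite eq_sym (negbTE ij) expr0.
Qed.

(** * Counting common zeros by reduction and interpolation *)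

Section CommonZeros.
Variables (I K : finType) (z : K -> I -> R) (M : nat) (h : I -> (I -> R) -> R).
Hypothesis hP : forall i, polyfun M (h i).
Hypothesis zP : forall u i, z u i ^+ M.+1 = h i (z u).

(** The members are functions on the set indexing the zeros, so congruence modulo the equations
    becomes plain equality. *)
Let redspan (v : K -> R) := exists C : {ffun I -> 'I_M.+1} -> R,
  forall u, v u = \sum_a C a * \prod_i z u i ^+ a i.

Let redspan_sum (T : Type) (s : seq T) (c : T -> R) (v : T -> K -> R) :
  (forall t, redspan (v t)) -> redspan (fun u => \sum_(t <- s) c t * v t u).
Proof.
move=> /choice[C vC]; exists (fun a => \sum_(t <- s) c t * C t a) => u.
under [RHS]eq_bigr do rewrite big_distrl.
rewrite exchange_big /=; apply: eq_bigr => t _; rewrite vC big_distrr /=.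
by apply: eq_bigr => a _; rewrite mulrA.
Qed.

(* A word with [M.+1] occurrences of a letter [i] is traded, at the common
   zeros, for [h i] times the rest, which has smaller degree. *)
Let redspan_word (w : seq I) : redspan (fun u => \prod_(i <- w) z u i).
Proof.
have [n] := ubnP (size w); elim: n w => // n IHn w /ltnSE wn.
have [/existsP[i Mi]|] := boolP [exists i, M < count_mem i w]%N; last first.
  rewrite negb_exists => /forallP Hw.
  exists (fun a => (a == [ffun i => inord (count_mem i w)])%:R) => u.
  rewrite prod_word_count (bigD1 [ffun i => inord (count_mem i w)])//= eqxx.
  rewrite mul1r [X in _ + X]big1 ?addr0.
    apply: eq_bigr => i _; rewrite ffunE inordK//.
    by rewrite ltnS leqNgt Hw.
  by move=> a /negbTE ->; rewrite mul0r.
set w' := [seq j <- w | j != i].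
have sw : (count_mem i w + size w' = size w)%N.
  by rewrite size_filter -(count_predC (pred1 i) w).
(* [M.+1] letters leave and [h i] brings back degree at most [M], so this bound equals
   [size w - 1]. *)
have fP : polyfun ((count_mem i w - M.+1) * 1 + (\sum_(j <- w') 1 + M))
    (fun x => x i ^+ (count_mem i w - M.+1) * (\prod_(j <- w') x j * h i x)).
  apply: polyfun_mul; first exact/polyfunX/polyfun_var.
  apply: polyfun_mul => //; apply: polyfun_prod_seq => j _.
  exact: polyfun_var.
have [s [/allP sk Hs]] := polyfun_words fP.
(* The filter removes nothing; it carries the size bound into the induction on the list of terms. *)
have -> : (fun u => \prod_(j <- w) z u j) =
    (fun u => \sum_(t <- [seq t <- s | size t.2 < n]%N)
       t.1 * \prod_(j <- t.2) z u j).
  apply/funext => u; rewrite (bigID (pred1 i)) /= -[X in _ * X]big_filter.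
  transitivity (z u i ^+ (count_mem i w - M.+1) *
      (\prod_(j <- w') z u j * h i (z u))).
    rewrite -zP mulrCA -exprD subnK// [RHS]mulrC; congr (_ * _).
    rewrite -big_filter (eq_big_seq (fun=> z u i)).
      by rewrite big_const_seq count_predT size_filter iter_mulr_1.
    by move=> j; rewrite mem_filter => /andP[/eqP ->].
  rewrite Hs; congr bigop; apply/esym/all_filterP/allP => t /sk.
  rewrite sum1_size; move: sw wn Mi; move: (count_mem _ _) (size w).
  by move: (size w') (size t.2) => *; lia.
have {sk} : all (fun t => size t.2 < n)%N [seq t <- s | size t.2 < n]%N.
  exact: filter_all.
elim: [seq _ <- s | _] => [_|t r IHr /= /andP[tn /IHr[C HC]]].
  exists (fun=> 0) => u; rewrite big_nil big1// => a _; rewrite mul0r //.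
have [C' HC'] := IHn _ tn.
exists (fun a => t.1 * C' a + C a) => u; rewrite big_cons HC' HC.
rewrite big_distrr -big_split; apply: eq_bigr => a _ /=.
by rewrite mulrA mulrDl.
Qed.

Let redspan_polyfun k f : polyfun k f -> redspan (f \o z).
Proof.
move=> /polyfun_words[s [_ Hs]].
rewrite (_ : f \o z = (fun u => \sum_(t <- s) t.1 * \prod_(i <- t.2) z u i)).
  by apply: redspan_sum => t; apply: redspan_word.
by apply/funext => u; rewrite /= Hs.
Qed.

(** Interpolation by a product of linear factors [x i - z u i], one for each [u] to avoid, with [i]
    a coordinate where [z u] and [z u0] differ. *)
Let separate (u0 : K) (s : seq K) : injective z -> u0 \notin s ->
  exists k f, [/\ polyfun k f, f (z u0) != 0 & {in s, forall u, f (z u) = 0}].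
Proof.
move=> zI; elim: s => [|u s IHs] => [_|].
  by exists 0%N, (fun=> 1); split=> //; [exact: polyfun_cst|exact: oner_neq0].
rewrite inE negb_or => /andP[u0u /IHs[k [f [fP f0 fs]]]].
have [i zi] : exists i, z u0 i != z u i.
  apply: contrapT => /forallNP zz; move/eqP: u0u; apply; apply: zI.
  by apply/funext => i; apply/eqP; have /negP/negPn := zz i.
exists (k + 1)%N, (fun x => f x * (x i - z u i)); split.
- apply: polyfun_mul fP _; apply: polyfunB (polyfunC _ _ _).
  exact: polyfun_var.
- by rewrite mulf_neq0// subr_eq0.
- move=> v; rewrite inE => /orP[/eqP ->|vs]; first by rewrite subrr mulr0.
  by rewrite fs// mul0r.
Qed.

(** The indicator of each zero is a combination of the [M.+1 ^ #|I|] reduced monomials, so the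
    identity matrix of size [#|K|] factors through a space of that dimension. *)
Lemma card_common_zeros : injective z -> (#|K| <= M.+1 ^ #|I|)%N.
Proof.
move=> zI.
have /choice[C HC] u0 : exists C : {ffun I -> 'I_M.+1} -> R, forall u,
    (u0 == u)%:R = \sum_a C a * \prod_i z u i ^+ a i.
  have [|k [f [fP f0 fs]]] := @separate u0 (enum (predC1 u0)) zI.
    by rewrite mem_enum inE eqxx.
  have [C HC] := redspan_polyfun fP.
  exists (fun a => (f (z u0))^-1 * C a) => u.
  under eq_bigr do rewrite -mulrA.
  rewrite -big_distrr -HC /=; have [<-|u0u] := eqVneq u0 u.
    by rewrite mulVf.
  by rewrite (fs u) ?mulr0// mem_enum inE eq_sym.
pose A : 'M[R]_(#|K|, #|{ffun I -> 'I_M.+1}|) :=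
  \matrix_(i, a) C (enum_val i) (enum_val a).
pose B : 'M[R]_(#|{ffun I -> 'I_M.+1}|, #|K|) :=
  \matrix_(a, j) \prod_i z (enum_val j) i ^+ (enum_val a : {ffun I -> 'I_M.+1}) i.
(* The inner identity matrix is the factor whose rank, the number of reduced monomials, bounds
   [#|K|]. *)
have AB : A *m 1%:M *m B = 1%:M.
  rewrite mulmx1; apply/matrixP => i j; rewrite !mxE.
  rewrite -(inj_eq (@enum_val_inj _ _)) HC [RHS]big_enum_val /=.
  by apply: eq_bigr => a _; rewrite !mxE.
have := mulmx1_min_rank AB; rewrite mxrank1.
by rewrite card_ffun card_ord.
Qed.

End CommonZeros.

End PolynomialFunctions.

(** * Counting sign patterns *)

Section SignPatterns.
Variable R : realType.

(** The inverse of one plus the sum of the reciprocals works, without a minimum over a possibly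
    empty set of positive values. *)
Lemma exists_pos_lt_all (T : finType) (a : T -> R) :
  exists2 e : R, 0 < e & forall t, 0 < a t -> e < a t.
Proof.
pose b t := if 0 < a t then (a t)^-1 else 0.
have b0 t : 0 <= b t by rewrite /b; case: ifPn => // /ltW; rewrite invr_ge0.
have s0 : 0 < 1 + \sum_t b t by rewrite ltr_pwDl// sumr_ge0.
exists (1 + \sum_t b t)^-1 => [|t at0]; first by rewrite invr_gt0.
rewrite -[ltRHS]invrK ltf_pV2 ?posrE ?invr_gt0//.
have <- : b t = (a t)^-1 by rewrite /b at0.
by rewrite (bigD1 t)//= addrCA ltrDl ltr_pwDl// sumr_ge0.
Qed.

(* The minimum of [lam * sum x_i^(E+2) - F] over the cell [g > 0] is negative
   while the function is nonnegative on the boundary and coercive, so it is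
   attained in the interior. *)
Lemma cell_critical_point (q E : nat) (J : finType) (lam : R)
    (g : J -> ('I_q -> R) -> R) (F : ('I_q -> R) -> R) (x0 : 'I_q -> R) :
  (forall j, exists k, polyfun k (g j)) -> polyfun E F -> ~~ odd E ->
  (forall j x, g j x = 0 -> F x = 0) -> 0 < lam ->
  (forall j, 0 < g j x0) -> lam * (\sum_i x0 i ^+ E.+2) < F x0 ->
  exists z, (forall j, 0 < g j z) /\ forall i (dF : ('I_q -> R) -> R),
    (forall (x : 'I_q -> R) t, is_derive t (1 : R) (fun t => F (upd x i t))
                           (dF (upd x i t))) ->
    lam * (E.+2%:R * z i ^+ E.+1) = dF z.
Proof.
move=> gP FP Eodd gF lam0 gx0 Fx0.
pose S (x : 'I_q -> R) := \sum_i x i ^+ E.+2.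
pose G x := lam * S x - F x.
have SP : polyfun (E.+2 * 1) S by apply: polyfun_sum => i _; apply/polyfunX/polyfun_var.
have GP : polyfun (E.+2 * 1) G.
  by apply: polyfunB; [exact: polyfunZ|apply: polyfun_le FP; lia].
have S_ge x i : x i ^+ E.+2 <= S x.
  rewrite /S (bigD1 i)//= lerDl sumr_ge0// => j _.
  by rewrite exprn_even_ge0//= negbK.
pose toV (x : 'I_q -> R) : 'rV[R]_q := \row_i x i.
have toVK x : (toV x) ord0 = x by apply/funext => i; rewrite mxE.
pose K : set 'rV[R]_q :=
  [set v | G (v ord0) <= 0 /\ forall j, 0 <= g j (v ord0)]%classic.
have cont k f : polyfun k f -> continuous (fun v : 'rV[R]_q => f (v ord0)).
  apply: (@polyfun_continuous R 'rV[R]_q 'I_q k f (fun v => v ord0)) => i.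
  exact: coord_continuous.
have Kclosed : closed K.
  have -> : K = ((fun v => G (v ord0)) @^-1` [set r | r <= 0] `&`
     \bigcap_(j in setT) (fun v => g j (v ord0)) @^-1` [set r | 0 <= r])%classic.
    apply/seteqP; split=> v [Gv gv]; split=> // j; first by move=> _; apply: gv.
    exact: gv.
  apply: closedI.
    by apply: closed_comp (@closed_le R 0) => v _; apply: cont GP v.
  apply: closed_bigI => j _; have [k gk] := gP j.
  by apply: closed_comp (@closed_ge R 0) => v _; apply: cont gk v.
(* If the largest coordinate has modulus [r >= 1], then [lam * r ^+ E.+2 <= C * r ^+ E], whence
   [r <= r ^+ 2 <= C / lam]; the summand 1 covers [r <= 1]. *)
have Kbounded : bounded_set K.
  have [C C0 HC] := polyfun_bound FP.
  exists (1 + C / lam); split=> [|M MB v [Gv _]]; first exact: num_real.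
  have M0 : 0 <= M.
    by apply: le_trans (ltW MB); rewrite addr_ge0// divr_ge0// ltW.
  rewrite /= [leLHS]/Num.norm /= mx_normrE; apply: bigmax_le => // -[o i] _ /=.
  rewrite ord1 {o}; pose i1 := [arg max_(j > i) `|v ord0 j|]%O.
  have i1P j : `|v ord0 j| <= `|v ord0 i1|.
    by rewrite /i1; case: arg_maxP => // k _; apply.
  apply: le_trans (i1P i) _.
  have [r1|/ltW r1] := leP `|v ord0 i1| 1.
    apply: le_trans (ltW MB); apply: le_trans r1 _.
    by rewrite lerDl divr_ge0// ltW.
  have := HC (v ord0) _ r1 i1P; set r := `|v ord0 i1| in r1 * => FB.
  have Er : lam * r ^+ E.+2 <= C * r ^+ E.
    apply: le_trans (le_trans (ler_norm _) FB).
    move: Gv; rewrite /G subr_le0; apply: le_trans.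
    rewrite ler_wpM2l ?(ltW lam0)//; apply: le_trans (S_ge _ i1).
    by rewrite /r -normrX ger0_norm// exprn_even_ge0//= negbK.
  have r0 : 0 < r by apply: lt_le_trans r1.
  have {}Er : r ^+ 2 <= C / lam.
    rewrite ler_pdivlMr// mulrC -(ler_pM2r (exprn_gt0 E r0)) -mulrA -exprD.
    exact: Er.
  apply: le_trans (ltW MB); apply: le_trans (_ : r ^+ 2 <= _).
    by rewrite expr2 ler_peMr// ltW.
  by apply: le_trans Er _; rewrite lerDr.
have Gx0 : G x0 < 0 by rewrite /G subr_lt0.
have Kx0 : K (toV x0) by split=> [|j]; rewrite toVK ltW.
have [|||c cK cmin] := @EVT_min_rV R q (fun v => G (v ord0)) K.
- by exists (toV x0).
- exact: bounded_closed_compact.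
- by apply: continuous_subspaceT => v; apply: cont GP v.
set z := c ord0 in cmin.
move: cK; rewrite inE => -[_ gz]; rewrite -/z in gz.
have Gz : G z < 0.
  apply: le_lt_trans Gx0; have := cmin (toV x0); rewrite toVK; apply.
  by rewrite inE.
have gz0 j : 0 < g j z.
  rewrite lt_neqAle gz andbT eq_sym; apply/eqP => /gF Fz.
  move: Gz; rewrite /G Fz subr0 ltNge mulr_ge0 ?(ltW lam0)// sumr_ge0// => i _.
  by rewrite exprn_even_ge0//= negbK.
exists z; split=> // i dF dFP.
have zE : (upd z i (z i)) = z.
  by apply/funext => j; rewrite /upd; case: eqP => [->|].
have lineC : forall j, continuous (fun t : R => (upd z i t) j).
  move=> j; rewrite /upd; case: (j == i); first by move=> t; apply: cvg_id.
  by move=> t; apply: cst_continuous.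
have near_pos : \forall t \near z i, forall j, 0 < g j (upd z i t).
  apply: (@filter_forall R J (fun j t => 0 < g j (upd z i t)) (nbhs (z i)) _).
  move=> j; have [k gk] := gP j.
  have /(_ (z i)) gc := polyfun_continuous lineC gk.
  apply: (gc [set r | 0 < r]%classic).
  by apply: open_nbhs_nbhs; split; [exact: open_gt|rewrite /= zE].
have [e /= e0 He] := near_pos.
pose Gl t := G (upd z i t).
have GlE : Gl = (fun t => lam * (t ^+ E.+2 + \sum_(j | j != i) z j ^+ E.+2)
    - F (upd z i t)).
  apply/funext => t; rewrite /Gl /G /S (bigD1 i)//= {1}/upd eqxx.
  congr (_ * (_ + _) - _); apply: eq_bigr => j /negbTE.
  by rewrite /upd => ->.
have dGl t : is_derive t (1 : R) Gl
    (lam * (E.+2%:R * t ^+ E.+1) - dF (upd z i t)).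
  rewrite GlE; apply: is_deriveB; apply: is_deriveZ.
  have dX := is_deriveD (is_deriveX E.+2 (is_derive_id t (1 : R)))
    (is_derive_cst (\sum_(j | j != i) z j ^+ E.+2) t (1 : R)).
  by rewrite addr0 /GRing.scale /= mulr1 exprfctE in dX.
have G0 : is_derive (z i) (1 : R) Gl 0.
  apply: (@derive1_at_min _ Gl (z i - e) (z i + e)).
  - lra.
  - by move=> t _; have [] := dGl t.
  - by rewrite in_itv /=; apply/andP; split; lra.
  - move=> t; rewrite in_itv /= => tz; rewrite /Gl zE.
    (* Minimality holds only on [K]; a nearby point outside it has [G] positive, hence above [G z],
       which is negative. *)
    have [Gt|/ltW Gt] := leP (G (upd z i t)) 0; last first.
      by apply: le_trans Gt; apply: ltW.
    have := cmin (toV (upd z i t)); rewrite toVK; apply.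
    rewrite inE; split; rewrite toVK// => j; apply/ltW/He => /=.
    by rewrite ltr_norml; apply/andP; split; lra.
apply/eqP; rewrite -subr_eq0 -[dF z](congr1 dF zE); apply/eqP.
have [_ <-] := dGl (z i).
by have [_ ->] := G0.
Qed.

(** Each pattern gets a critical point inside its own open cell. The cells are pairwise disjoint, so
    these points are distinct, and the critical equations bound their number. *)
Let sign_patterns_ord (q : nat) (J : finType) (D : nat)
    (f : J -> ('I_q -> R) -> R) (A : {set {ffun J -> bool}}) :
  (forall j, polyfun D (f j)) ->
  (forall s, s \in A -> exists x, forall j, s j = (0 < f j x)) ->
  (#|A| <= (2 * (#|J| * D)).+1 ^ q)%N.
Proof.
move=> fP AP.
have /choice[x xP] s : exists x, s \in A -> forall j, s j = (0 < f j x).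
  have [/AP[x Hx]|] := boolP (s \in A); first by exists x.
  by exists (fun=> 0).
(* Subtracting [e] keeps the positive values at the witnesses positive and makes the others, zero
   included, strictly negative. *)
have [e e0 eP] := exists_pos_lt_all
  (fun t : {ffun J -> bool} * J => f t.2 (x t.1)).
pose f' j y := f j y - e.
have f'P j : polyfun D (f' j) by apply: polyfunB (polyfunC _ _ _).
pose F y := \prod_j f' j y ^+ 2.
set E := (2 * (#|J| * D))%N.
have FP : polyfun E F.
  rewrite /E mulnCA; apply: polyfun_prod => j _; exact: polyfunX.
pose g (s : {ffun J -> bool}) j y := (-1) ^+ (~~ s j) * f' j y.
have gP (s : {ffun J -> bool}) j : exists k, polyfun k (g s j).
  by exists D; apply: polyfunZ.
have gF s j y : g s j y = 0 -> F y = 0.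
  move=> /eqP; rewrite mulf_eq0 signr_eq0 /= => /eqP fy.
  by rewrite /F (bigD1 j)//= fy expr0n mul0r.
have f'x s : s \in A -> forall j, s j = (0 < f' j (x s)) /\ f' j (x s) != 0.
  move=> sA j; have := xP s sA j; have := eP (s, j); rewrite /f' /= subr_eq0.
  have [f0 fe ->|f0 _ ->] := ltP 0 (f j (x s)).
    by rewrite subr_gt0 fe// gt_eqF// fe.
  by rewrite subr_gt0 lt_eqF ?(le_lt_trans f0)// ltNge (le_trans f0 (ltW e0)).
have gx s : s \in A -> forall j, 0 < g s j (x s).
  move=> sA j; have [+ fn0] := f'x s sA j; rewrite /g => sj.
  case: (s j) sj => /= sj; first by rewrite expr0 mul1r -sj.
  by rewrite expr1 mulN1r oppr_gt0 lt_neqAle fn0 leNgt -sj.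
have Fx s : s \in A -> 0 < F (x s).
  move=> sA; apply: prodr_gt0 => j _; rewrite exprn_even_gt0//=.
  by have [] := f'x s sA j.
pose S (y : 'I_q -> R) := \sum_i y i ^+ E.+2.
have Eodd : ~~ odd E by rewrite /E oddM.
have S0 y : 0 <= S y.
  by rewrite sumr_ge0// => j _; rewrite exprn_even_ge0//= negbK.
have S1 y : 0 < S y + 1 by rewrite ltr_wpDl.
(* This gives [lam * (S + 1) < F] at every witness; the added 1 keeps the denominator positive. *)
have [lam lam0 lamP] := exists_pos_lt_all (fun s => F (x s) / (S (x s) + 1)).
have /choice[dF dFP] i := polyfun_partial i FP.
have /choice[z zP] (s : {s | s \in A}) : exists z,
    (forall j, 0 < g (val s) j z) /\
    forall i, lam * (E.+2%:R * z i ^+ E.+1) = dF i z.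
  have sA := valP s.
  have [|z [gz dz]] :=
    cell_critical_point (gP (val s)) FP Eodd (gF (val s)) lam0 (gx _ sA).
    have := lamP (val s); rewrite divr_gt0 ?Fx// => /(_ isT).
    rewrite ltr_pdivlMr//; apply: le_lt_trans.
    by rewrite ler_pM2l// lerDl.
  exists z; split=> // i; apply: dz => y t.
  by have [_ _] := dFP i.
have zI : injective z.
  move=> s t zst; apply/val_inj/ffunP => j.
  have [/(_ j) + _] := zP s; have [/(_ j) + _] := zP t; rewrite /g zst.
  by case: (val s j) (val t j) => -[] //=; rewrite expr0 expr1; lra.
rewrite -(card_ord q) -card_sig.
pose h i (y : 'I_q -> R) := (lam * E.+2%:R)^-1 * dF i y.
apply: (@card_common_zeros R _ _ z E h) => // [i|s i].
  apply: polyfunZ; have [+ _ _] := dFP i; apply: polyfun_le.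
  exact: leq_pred.
have [_ /(_ i) dz] := zP s; rewrite /h -dz (mulrA lam) mulKf//.
by rewrite mulf_neq0 ?pnatr_eq0// gt_eqF.
Qed.

Lemma card_sign_patterns (I J : finType) (D : nat)
    (f : J -> (I -> R) -> R) (A : {set {ffun J -> bool}}) :
  (forall j, polyfun D (f j)) ->
  (forall s, s \in A -> exists x, forall j, s j = (0 < f j x)) ->
  (#|A| <= (2 * (#|J| * D)).+1 ^ #|I|)%N.
Proof.
move=> fP AP.
apply: (@sign_patterns_ord _ _ _ (fun j v => f j (v \o enum_rank))) => [j|s sA].
  exact: polyfun_reindex.
have [x xP] := AP s sA; exists (x \o enum_val) => j.
by rewrite xP; congr (0 < f j _); apply/funext => i /=; rewrite enum_rankK.
Qed.

End SignPatterns.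

(** * Symmetrization *)

Section UniformConvergence.
Variable R : realType.

(** The sub-Gaussian bound for a random sign, with a generous constant. For [x >= 1/2] it follows
    from [x <= 2 * x ^+ 2]; for smaller [x], from [expR y <= (1 - y)^-1]. *)
Lemma expR_addN_le (x : R) : expR x + expR (- x) <= 2 * expR (2 * x ^+ 2).
Proof.
wlog x0 : x / 0 <= x => [H|].
  have [/H//|/ltW x0] := leP 0 x.
  by have := H (- x); rewrite opprK sqrrN addrC; apply; rewrite oppr_ge0.
have [x2|x2] := leP (1 / 2) x.
  have x2x : x <= 2 * x ^+ 2 by rewrite expr2; nra.
  have e1 : expR x <= expR (2 * x ^+ 2) by rewrite ler_expR.
  have e2 : expR (- x) <= expR (2 * x ^+ 2) by rewrite ler_expR; lra.
  lra.
have ub (y : R) : y < 1 -> expR y <= (1 - y)^-1.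
  move=> y1; rewrite -[expR y]invrK lef_pV2 ?posrE ?invr_gt0 ?expR_gt0 ?subr_gt0//.
  by rewrite -expRN (le_trans _ (expR_ge1Dx _)).
have u0 : 0 <= x ^+ 2 := sqr_ge0 x.
have u4 : x ^+ 2 <= 1 / 4 by rewrite expr2; nra.
have e1 : expR x <= (1 - x)^-1 by apply: ub; lra.
have e2 : expR (- x) <= (1 + x)^-1.
  by apply: (le_trans (ub _ _)); rewrite ?opprK//; lra.
have e3 := expR_ge1Dx (2 * x ^+ 2).
apply: le_trans (lerD e1 e2) _; apply: le_trans (_ : 2 * (1 + 2 * x ^+ 2) <= _).
  have -> : (1 - x)^-1 + (1 + x)^-1 = 2 / (1 - x ^+ 2).
    by field; apply/and3P; split; rewrite gt_eqF//; lra.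
  by rewrite ler_pdivrMr; nra.
by rewrite ler_pM2l.
Qed.

Definition mean (T : finType) (g : T -> R) : R := #|T|%:R^-1 * \sum_t g t.

Lemma le_mean (T : finType) (g h : T -> R) :
  (forall t, g t <= h t) -> mean g <= mean h.
Proof. by move=> gh; rewrite /mean ler_wpM2l ?invr_ge0// ler_sum. Qed.

(** Jensen's inequality: the exponential lies above its tangent line at the mean, and averaging
    kills the linear term. *)
Lemma expR_mean_le (T : finType) (g : T -> R) : (0 < #|T|)%N ->
  expR (mean g) <= mean (fun t => expR (g t)).
Proof.
move=> T0; have T0' : (#|T|%:R : R) != 0 by rewrite pnatr_eq0 -lt0n.
set a := mean g.
apply: le_trans (_ : mean (fun t => expR a * (1 + (g t - a))) <= _); last first.
  apply: le_mean => t; have := expR_ge1Dx (g t - a).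
  by rewrite -(ler_pM2l (expR_gt0 a)) -expRD subrKC.
have sg : \sum_t g t = #|T|%:R * a by rewrite /a /mean mulVKf.
rewrite /mean -big_distrr big_split /= sumrB sg !sumr_const.
rewrite -[a *+ _]mulr_natl subrr addr0 mulrCA.
by rewrite (_ : _^-1 * _ = 1) ?mulr1//; apply: mulVf.
Qed.

(** Independence of the coordinates under the uniform law on a power of [T]. *)
Lemma prod_mean (I T : finType) (g : I -> T -> R) :
  \prod_i mean (g i) = mean (fun f : {ffun I -> T} => \prod_i g i (f i)).
Proof.
rewrite /mean -bigA_distr_bigA big_split /=; congr (_ * _).
by rewrite prodr_const card_ffun natrX exprVn.
Qed.

Section Symmetrization.
Variables (Z : finType) (n : nat) (F : {set {ffun Z -> bool}}).

Definition risk (f : {ffun Z -> bool}) : R := mean (fun z => (f z)%:R).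
Definition emp (f : {ffun Z -> bool}) (S : {ffun 'I_n -> Z}) : R :=
  n%:R^-1 * \sum_i (f (S i))%:R.

Definition traces (K : finType) (T : {ffun K -> Z}) : {set {ffun K -> bool}} :=
  [set [ffun k => f (T k)] | f : {ffun Z -> bool} in F].

(** The Boolean separates the ghost sample ([true]) from the given sample ([false]). *)
Let diff (v : {ffun 'I_n * bool -> bool}) i : R :=
  (v (i, true))%:R - (v (i, false))%:R.
Let cosh2 mu v := expR (mu * \sum_i diff v i) + expR (- (mu * \sum_i diff v i)).
(** Summing over the patterns replaces the supremum over [F], which is the union bound; the two
    exponentials in [cosh2] handle both signs of the deviation. *)
Let Q mu (T : {ffun 'I_n * bool -> Z}) := \sum_(v in traces T) cosh2 mu v.
Let join (S S' : {ffun 'I_n -> Z}) : {ffun 'I_n * bool -> Z} :=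
  [ffun k => if k.2 then S' k.1 else S k.1].

Let cosh2_ge0 mu v : 0 <= cosh2 mu v.
Proof. by rewrite addr_ge0// expR_ge0. Qed.

Let Q_ge0 mu T : 0 <= Q mu T.
Proof. exact: sumr_ge0. Qed.

(** The risk is the mean loss on a ghost point. Jensen is applied to each coordinate, and the
    product of means is a mean over ghost samples. *)
Let jensen mu f S : (0 < n)%N -> (0 < #|Z|)%N ->
  expR (mu * (n%:R * (risk f - emp f S))) <=
  mean (fun S' => expR (mu * \sum_i diff [ffun k => f (join S S' k)] i)).
Proof.
move=> n0 Z0.
have -> : mu * (n%:R * (risk f - emp f S)) =
    \sum_i mean (fun z => mu * ((f z)%:R - (f (S i))%:R)).
  have E c : mean (fun z => mu * ((f z)%:R - c)) = mu * (risk f - c).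
    rewrite /risk /mean -big_distrr /= sumrB sumr_const mulrCA mulrBr.
    by rewrite -[X in _ - _ * X]mulr_natl mulKf// pnatr_eq0 -lt0n.
  under eq_bigr do rewrite E.
  rewrite -big_distrr sumrB /= sumr_const card_ord -[risk f *+ n]mulr_natl /emp mulrBr.
  by rewrite mulVKf// pnatr_eq0 -lt0n.
rewrite expR_sum.
apply: le_trans (_ : \prod_i
    mean (fun z => expR (mu * ((f z)%:R - (f (S i))%:R))) <= _).
  by apply: ler_prod => i _; rewrite expR_ge0 expR_mean_le.
rewrite prod_mean; apply: le_mean => S'.
rewrite -expR_sum big_distrr /= ler_expR le_eqVlt; apply/orP; left; apply/eqP.
by apply: eq_bigr => i _; rewrite /diff !ffunE.
Qed.

(** [eta] selects the indices at which the ghost point and the given point trade places. *)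
Let swap (eta : {ffun 'I_n -> bool}) (k : 'I_n * bool) := (k.1, k.2 (+) eta k.1).

Let swapK eta : involutive (swap eta).
Proof. by move=> [i b]; rewrite /swap /= -addbA addbb addbF. Qed.

Let act (X : Type) (eta : {ffun 'I_n -> bool}) (T : {ffun 'I_n * bool -> X}) :
  {ffun 'I_n * bool -> X} := [ffun k => T (swap eta k)].

Let actK (X : Type) eta : involutive (@act X eta).
Proof. by move=> T; apply/ffunP => k; rewrite !ffunE swapK. Qed.

(** Swapping sample points swaps the entries of every trace, so the randomness moves from the sample
    to the patterns. *)
Let Q_act mu eta T : Q mu (act eta T) = \sum_(v in traces T) cosh2 mu (act eta v).
Proof.
have E : traces (act eta T) = [set act eta v | v in traces T].
  rewrite /traces -imset_comp; apply: eq_imset => f.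
  by apply/ffunP => k; rewrite !ffunE.
by rewrite /Q E big_imset//; apply: in2W; exact: inv_inj (@actK bool eta).
Qed.

(** A swap at [i] flips the sign of [diff v i], so the mean factors into averages over one random
    sign, each bounded through [expR_addN_le] since [diff] has modulus at most 1. *)
Let mean_exp_act mu v : mean (fun eta : {ffun 'I_n -> bool} =>
  expR (mu * \sum_i diff (act eta v) i)) <= expR (2 * mu ^+ 2 * n%:R).
Proof.
have dE (eta : {ffun 'I_n -> bool}) i :
    diff (act eta v) i = (-1) ^+ eta i * diff v i.
  rewrite /diff !ffunE /swap /=; case: (eta i) => /=.
    by rewrite expr1 mulN1r opprB.
  by rewrite expr0 mul1r.
under [X in mean X]eq_fun => eta.
  rewrite big_distrr /=; under eq_bigr do rewrite dE.
  rewrite expR_sum; over.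
rewrite -(prod_mean (fun i (b : bool) => expR (mu * ((-1) ^+ b * diff v i)))).
apply: le_trans (_ : \prod_(i < n) expR (2 * mu ^+ 2) <= _); last first.
  by rewrite prodr_const card_ord -expRM_natr.
apply: ler_prod => i _; rewrite /mean card_bool big_bool /= expr0 expr1.
rewrite mul1r mulN1r mulrN.
have d1 : (mu * diff v i) ^+ 2 <= mu ^+ 2.
  rewrite exprMn ler_piMr ?sqr_ge0// /diff.
  by case: (v _); case: (v _); rewrite /= ?subrr ?subr0 ?sub0r ?sqrrN ?expr1n// expr0n.
have := expR_addN_le (mu * diff v i).
have : expR (2 * (mu * diff v i) ^+ 2) <= expR (2 * mu ^+ 2).
  by rewrite ler_expR ler_pM2l.
have := expR_ge0 (mu * diff v i); have := expR_ge0 (- (mu * diff v i)).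
by move=> *; apply/andP; split; lra.
Qed.

(** The sum over [T] is invariant under each swap, so it may be averaged over [eta]. The set of
    traces of [T] does not depend on [eta], and each trace contributes at most twice the bound for
    one sign. *)
Let sum_Q_le mu N : (forall T : {ffun 'I_n * bool -> Z}, #|traces T| <= N)%N ->
  \sum_T Q mu T <=
  #|{ffun 'I_n * bool -> Z}|%:R * (2 * N%:R * expR (2 * mu ^+ 2 * n%:R)).
Proof.
move=> HN.
have B0 : (0 < #|{ffun 'I_n -> bool}|)%N.
  by rewrite card_ffun card_bool expn_gt0.
have -> : \sum_T Q mu T =
    \sum_T \sum_(v in traces T) mean (fun eta => cosh2 mu (act eta v)).
  have E (eta : {ffun 'I_n -> bool}) : \sum_T Q mu T =
      \sum_T \sum_(v in traces T) cosh2 mu (act eta v).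
    rewrite (reindex_inj (inv_inj (@actK Z eta))).
    by apply: eq_bigr => T _; rewrite Q_act.
  transitivity (#|{ffun 'I_n -> bool}|%:R^-1 *
      \sum_(eta : {ffun 'I_n -> bool}) \sum_T Q mu T).
    by rewrite sumr_const -[(\sum_T Q mu T) *+ _]mulr_natl mulKf// pnatr_eq0 -lt0n.
  under eq_bigr => eta _ do rewrite (E eta); rewrite exchange_big big_distrr /=.
  by apply: eq_bigr => T _; rewrite exchange_big big_distrr.
rewrite mulr_natl -sumr_const; apply: ler_sum => T _.
apply: le_trans (_ : \sum_(v in traces T) (2 * expR (2 * mu ^+ 2 * n%:R)) <= _).
  apply: ler_sum => v _.
  have e1 := mean_exp_act mu v; have e2 := mean_exp_act (- mu) v.
  rewrite sqrrN in e2; rewrite mulr2n mulrDl mul1r.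
  apply: le_trans (lerD e1 e2); rewrite /mean -mulrDr -big_split /=.
  by rewrite ler_wpM2l ?invr_ge0//; apply: ler_sum => eta _; rewrite mulNr.
rewrite sumr_const -[leLHS]mulr_natl mulrCA mulrA ler_wpM2r ?expR_ge0//.
by rewrite ler_pM2l// ler_nat.
Qed.

(** Markov's inequality in counting form, applied to the mean of [Q] over ghost samples. *)
Lemma uniform_deviation N (eps : R) : (0 < n)%N -> 0 <= eps ->
  (forall T : {ffun 'I_n * bool -> Z}, #|traces T| <= N)%N ->
  #|[set S : {ffun 'I_n -> Z} |
      [exists f in F, eps < `|risk f - emp f S|]]|%:R <=
  #|{ffun 'I_n -> Z}|%:R * (2 * N%:R * expR (- (n%:R * eps ^+ 2 / 8))).
Proof.
move=> n0 eps0 HN; set B := [set S | _].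
have [Z0|] := posnP #|Z|.
  rewrite [#|B|]eq_card0 ?mulr_ge0 ?expR_ge0// => S.
  by have /card0_eq/(_ (S (Ordinal n0))) := Z0; rewrite inE.
(* This value minimizes the exponent [2 * mu ^+ 2 * n - mu * n * eps], giving
   [- n * eps ^+ 2 / 8]. *)
move=> Z0; pose mu := eps / 4.
have M0 : (0 : R) < #|{ffun 'I_n -> Z}|%:R.
  by rewrite ltr0n card_ffun expn_gt0 Z0.
have badP S : S \in B ->
    expR (mu * (n%:R * eps)) <= mean (fun S' => Q mu (join S S')).
  rewrite inE => /existsP[f /andP[fF fS]].
  have QE S' : cosh2 mu [ffun k => f (join S S' k)] <= Q mu (join S S').
    rewrite /Q (bigD1 [ffun k => f (join S S' k)]) ?imset_f//=.
    by rewrite lerDl sumr_ge0.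
  have mu0 : 0 <= mu by rewrite divr_ge0.
  have [r0|r0] := leP 0 (risk f - emp f S).
    rewrite ger0_norm// in fS.
    apply: le_trans (_ : expR (mu * (n%:R * (risk f - emp f S))) <= _).
      by rewrite ler_expR ler_wpM2l// ler_wpM2l// ltW.
    apply: le_trans (jensen mu f S n0 Z0) _; apply: le_mean => S'.
    by apply: le_trans (QE S'); rewrite /cosh2 lerDl expR_ge0.
  rewrite ltr0_norm// in fS.
  apply: le_trans (_ : expR (- mu * (n%:R * (risk f - emp f S))) <= _).
    by rewrite ler_expR mulNr -mulrN ler_wpM2l// -mulrN ler_wpM2l// ltW.
  apply: le_trans (jensen (- mu) f S n0 Z0) _; apply: le_mean => S'.
  by apply: le_trans (QE S'); rewrite /cosh2 mulNr lerDr expR_ge0.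
have sumQ : \sum_S \sum_S' Q mu (join S S') = \sum_T Q mu T.
  rewrite pair_big /=; apply/esym.
  apply: (reindex (fun p => join p.1 p.2)).
  exists (fun T : {ffun 'I_n * bool -> Z} =>
            ([ffun i => T (i, false)], [ffun i => T (i, true)])) => [[S S']|T] _.
    by congr pair; apply/ffunP => i; rewrite !ffunE.
  by apply/ffunP => -[i []]; rewrite !ffunE.
have cardT : #|{ffun 'I_n * bool -> Z}|%:R =
    #|{ffun 'I_n -> Z}|%:R * #|{ffun 'I_n -> Z}|%:R :> R.
  rewrite -natrM !card_ffun -expnD card_prod card_bool.
  by congr (_%:R); congr (_ ^ _)%N; lia.
have main : #|B|%:R * expR (mu * (n%:R * eps)) <=
    #|{ffun 'I_n -> Z}|%:R * (2 * N%:R * expR (2 * mu ^+ 2 * n%:R)).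
  rewrite -(ler_pM2l M0) [leRHS]mulrA -cardT.
  apply: le_trans (sum_Q_le mu HN); rewrite -sumQ.
  have -> : #|B|%:R * expR (mu * (n%:R * eps)) =
      \sum_(S in B) expR (mu * (n%:R * eps)) by rewrite sumr_const mulr_natl.
  rewrite big_distrr /= [leRHS](bigID (mem B)) /=.
  rewrite -[leLHS]addr0 lerD//; last first.
    by apply: sumr_ge0 => S _; apply: sumr_ge0.
  apply: ler_sum => S /badP; rewrite /mean [leRHS]mulrC ler_pdivlMr//.
  by rewrite mulrC.
rewrite -(ler_pM2r (expR_gt0 (mu * (n%:R * eps)))).
apply: le_trans main _; rewrite -!mulrA -expRD ler_pM2l// ler_pM2l// ler_wpM2l//.
rewrite ler_expR /mu le_eqVlt; apply/orP; left; apply/eqP.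
by field.
Qed.

End Symmetrization.

End UniformConvergence.

(** * Error patterns of the network *)

Section Activations.
Variable R : realType.

(* On nonnegative integer inputs [x] of size at most [m], a neuron
   [sigma (w . x)] is a quotient [N / Q] of polynomials in finitely many
   functions [phi] of the individual weights; the numerator depends on the signs
   of finitely many other such polynomials [T]. *)
Definition poly_repr (sigma : R -> R) (e D L : nat) (phi : R -> 'I_e -> R) :=
  forall (p m : nat) (x : 'I_p -> nat), (\sum_r x r <= m)%N ->
  exists (T : 'I_L -> ('I_p * 'I_e -> R) -> R)
         (N : {ffun 'I_L -> bool} -> ('I_p * 'I_e -> R) -> R)
         (Q : ('I_p * 'I_e -> R) -> R),
    [/\ forall l, polyfun (D * m.+1) (T l),
        forall b, polyfun (D * m.+1) (N b),
        polyfun (D * m.+1) Q &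
        forall w : 'I_p -> R, let u k := phi (w k.1) k.2 in
          0 < Q u /\ sigma (\sum_r w r * (x r)%:R) * Q u =
                     N [ffun l => 0 < T l u] u].

Lemma polyfun_dot (I T : finType) (h : T -> I) (x : T -> nat) :
  polyfun 1 (fun u : I -> R => \sum_r u (h r) * (x r)%:R).
Proof.
apply: polyfun_sum => r _; rewrite (_ : (fun _ => _) = fun u => (x r)%:R * u (h r)).
  exact/polyfunZ/polyfun_var.
by apply/funext => u; rewrite mulrC.
Qed.

(** The signs of [dot - b l] locate the piece: the first [l] at which the strict test [b l < t]
    fails, in agreement with intervals closed on the right. *)
Lemma piecewise_poly_repr sigma L r : (1 <= L)%N ->
  piecewise_poly_act sigma L r ->
  exists e D L' phi, @poly_repr sigma e D L' phi.
Proof.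
move=> L1 [b [P [sb _ sP degP sigmaP]]].
exists 1%N, r.+1, (size b), (fun w _ => w) => p m x _.
pose dot (u : 'I_p * 'I_1 -> R) := \sum_r u (r, ord0) * (x r)%:R.
have dotP : polyfun 1 dot by apply: polyfun_dot.
(* If every test succeeds, [find] returns the length [L.-1], the index of the last piece. *)
pose piece (s : {ffun 'I_(size b) -> bool}) :=
  find negb [seq s l | l <- enum 'I_(size b)].
have pieceL s : (piece s < L)%N.
  apply: leq_ltn_trans (find_size _ _) _.
  by rewrite size_map size_enum_ord sb; lia.
exists (fun l u => dot u - nth 0 b l), (fun s u => (nth 0 P (piece s)).[dot u]),
  (fun=> 1); split=> [l|s||w u].
- by apply: polyfunB (polyfunC _ _ _); apply: polyfun_le dotP; lia.
- by apply: polyfun_le (polyfun_horner _ dotP); have := degP _ (pieceL s); lia.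
- exact: polyfunC.
split; first exact: ltr01.
rewrite mulr1; set t := \sum_(r < p) _; set s := [ffun l => _].
have -> : dot u = t by [].
have pieceE : piece s = find (fun y => ~~ (y < t)) b.
  rewrite /piece (_ : [seq _ | _ <- _] = [seq y < t | y <- b]).
    by rewrite find_map.
  apply: (@eq_from_nth _ false); rewrite size_map size_enum_ord ?size_map//.
  move=> i ib; rewrite (nth_map (Ordinal ib)) ?size_enum_ord//.
  by rewrite (nth_map 0)// ffunE subr_gt0 nth_enum_ord.
apply: sigmaP => //; rewrite pieceE.
  case: (find _ b) (@before_find _ 0 (fun y => ~~ (y < t)) b) => // k kP.
  by rewrite /= -[_ < _]negbK kP.
have [bt|] := boolP (has (fun y => ~~ (y < t)) b).
  by have := nth_find 0 bt; rewrite -leNgt => ->; rewrite orbT.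
by move=> /hasNfind ->; rewrite sb eqxx.
Qed.

(** As the inputs are integers, the addition formulas expand the cosine and sine of [k * (w . x)] in
    those of the weights, with degree [k] times the size of [x]. No sign test is used. *)
Lemma trig_poly_repr sigma K : trig_poly_act sigma K ->
  exists e D L' phi, @poly_repr sigma e D L' phi.
Proof.
move=> [a0 [a [bb sigmaP]]].
pose phi w (i : 'I_2) := if i == ord0 then cos w else sin w : R.
exists 2, K, 0%N, phi => p m x xm.
pose u (w : 'I_p -> R) (k : 'I_p * 'I_2) := phi (w k.1) k.2.
(* Cosine and sine are carried together because the addition formulas mix them. *)
pose cs D (h : ('I_p -> R) -> R) := exists C S, [/\ polyfun D C, polyfun D S &
  forall w, C (u w) = cos (h w) /\ S (u w) = sin (h w)].
have cs0 D : cs D (fun=> 0).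
  exists (fun=> 1), (fun=> 0); split; try exact: polyfunC.
  by move=> w; rewrite cos0 sin0.
have csD D D' h h' : cs D h -> cs D' h' -> cs (D + D')%N (fun w => h w + h' w).
  move=> [C [S [CP SP CS]]] [C' [S' [CP' SP' CS']]].
  exists (fun v => C v * C' v - S v * S' v), (fun v => S v * C' v + C v * S' v).
  split; [by apply: polyfunB; apply: polyfun_mul|
          by apply: polyfun_add; apply: polyfun_mul|].
  by move=> w; have [-> ->] := CS w; have [-> ->] := CS' w; rewrite cosD sinD.
have csM n D h : cs D h -> cs (n * D)%N (fun w => n%:R * h w).
  move=> hP; elim: n => [|n IHn].
    by rewrite (_ : (fun _ => _) = fun=> 0)//; apply/funext => w; rewrite mul0r.
  rewrite mulSn (_ : (fun _ => _) = fun w => h w + n%:R * h w).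
    exact: csD.
  by apply/funext => w; rewrite -[n.+1]add1n natrD mulrDl mul1r.
have cs_dot : cs (\sum_r x r)%N (fun w => \sum_r w r * (x r)%:R).
  elim: (index_enum _) => [|r s IHs].
    by rewrite big_nil (_ : (fun _ => _) = fun=> 0)//; apply/funext => w; rewrite big_nil.
  rewrite big_cons (_ : (fun _ => _) = fun w : 'I_p -> R =>
     (x r)%:R * w r + \sum_(j <- s) w j * (x j)%:R).
    apply: csD IHs; rewrite -[X in cs X]muln1; apply: csM.
    exists (fun v => v (r, ord0)), (fun v => v (r, lift ord0 ord0)).
    by split=> [||w]; try exact: polyfun_var.
  by apply/funext => w; rewrite big_cons mulrC.
have /choice[C /choice[S CS]] k := csM k _ _ cs_dot.
exists (fun _ _ => 0), (fun _ v => a0 +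
  \sum_(1 <= k < K.+1) (a k * C k v + bb k * S k v)), (fun=> 1).
split=> [[]//|_||w].
- apply: polyfun_add; first exact: polyfunC.
  rewrite (_ : (fun _ => _) = (fun v =>
    \sum_(k <- index_iota 1 K.+1 | (k < K.+1)%N) (a k * C k v + bb k * S k v))).
    apply: polyfun_sum => k kK; have [CP SP _] := CS k.
    have kD : (k * \sum_r x r <= K * m.+1)%N by rewrite leq_mul// (leq_trans xm).
    by apply: polyfun_add; apply: polyfunZ; [apply: polyfun_le CP|apply: polyfun_le SP].
  by apply/funext => v; rewrite big_nat_cond [RHS]big_nat_cond; apply: eq_bigl => k; lia.
- exact: polyfunC.
split; first exact: ltr01.
rewrite mulr1 sigmaP; congr (_ + _); apply: eq_bigr => k _.
by have [_ _ /(_ w)[-> ->]] := CS k.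
Qed.

(** For integer inputs, [expR (k * (w . x))] is a monomial of degree at most [m] in the
    [expR (k * w r)]. These and the [w r] serve as separate variables. *)
Lemma pre_repr sigma : pre_act sigma ->
  exists e D L' phi, @poly_repr sigma e D L' phi.
Proof.
move=> [k [c [tau [a [bb [P [_ c0 tau0 sigmaP]]]]]]].
pose phi w (i : 'I_2) := if i == ord0 then w else expR (k * w) : R.
exists 2, (size P).+1, 0%N, phi => p m x xm.
pose dot (v : 'I_p * 'I_2 -> R) := \sum_r v (r, ord0) * (x r)%:R.
pose E (v : 'I_p * 'I_2 -> R) := \prod_r v (r, lift ord0 ord0) ^+ x r.
have dotP : polyfun 1 dot by apply: polyfun_dot.
have EP : polyfun m E.
  apply: polyfun_le xm _; apply: polyfun_prod_seq => r _.
  by rewrite -[X in polyfun X]muln1; apply/polyfunX/polyfun_var.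
have linP s s' : polyfun m (fun v => s * E v + s').
  by apply: polyfun_add; [exact: polyfunZ|exact: polyfunC].
exists (fun _ _ => 0), (fun _ v => P.[dot v] * (a * E v + bb)),
  (fun v => c * E v + tau); split=> [[]//|_||w u].
- by apply: polyfun_le (polyfun_mul (polyfun_horner P dotP) (linP _ _)); lia.
- by apply: polyfun_le (linP _ _); lia.
have Eu : E u = expR (k * \sum_r w r * (x r)%:R).
  rewrite big_distrr expR_sum; apply: eq_bigr => r _.
  by rewrite /= mulrA expRM_natr.
have Q0 : 0 < c * E u + tau by rewrite ltr_wpDl// mulr_ge0// Eu expR_ge0.
split=> //; rewrite sigmaP Eu -mulrA divfK// -Eu; exact: lt0r_neq0.
Qed.

Lemma activation_repr sigma : activation_family sigma ->
  exists e D L phi, @poly_repr sigma e D L phi.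
Proof.
move=> [[L [r [L1 _]]]|[[K]|]].
- exact: piecewise_poly_repr.
- exact: trig_poly_repr.
- exact: pre_repr.
Qed.

End Activations.

(** * Growth function of the network *)

Section Growth.
Variable R : realType.

(** The first pattern selects the polynomials of the second stage, so the number of outcomes is at
    most the number of first patterns times a uniform bound on the second. *)
Lemma card_two_stage (I J1 J2 X : finType) (D1 D2 : nat)
    (f1 : J1 -> (I -> R) -> R)
    (f2 : {ffun J1 -> bool} -> J2 -> (I -> R) -> R)
    (dec : {ffun J2 -> bool} -> X) (A : {set X}) :
  (forall j, polyfun D1 (f1 j)) -> (forall s j, polyfun D2 (f2 s j)) ->
  (forall a, a \in A -> exists x, a = dec [ffun j =>
     0 < f2 [ffun i => 0 < f1 i x] j x]) ->
  (#|A| <= (2 * (#|J1| * D1)).+1 ^ #|I| * (2 * (#|J2| * D2)).+1 ^ #|I|)%N.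
Proof.
move=> f1P f2P AP.
pose A1 := [set s : {ffun J1 -> bool} | `[< exists x, forall j, s j = (0 < f1 j x) >]].
pose A2 s1 := [set s : {ffun J2 -> bool} |
  `[< exists x, forall j, s j = (0 < f2 s1 j x) >]].
have A1P : (#|A1| <= (2 * (#|J1| * D1)).+1 ^ #|I|)%N.
  by apply: card_sign_patterns f1P _ => s; rewrite inE => /asboolP.
have A2P s1 : (#|A2 s1| <= (2 * (#|J2| * D2)).+1 ^ #|I|)%N.
  by apply: card_sign_patterns (f2P s1) _ => s; rewrite inE => /asboolP.
have AS : A \subset finset.cover [set dec @: A2 s1 | s1 in A1].
  apply/fintype.subsetP => a /AP[x ->]; set s1 := [ffun i => 0 < f1 i x].
  apply/bigcupP; exists (dec @: A2 s1).
    apply: imset_f; rewrite inE; apply/asboolP; exists x => j.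
    by rewrite ffunE.
  apply: imset_f; rewrite inE; apply/asboolP; exists x => j.
  by rewrite ffunE.
apply: leq_trans (subset_leq_card AS) _.
apply: leq_trans (leq_card_cover _) _.
apply: leq_trans (_ : \sum_(B in [set dec @: A2 s1 | s1 in A1])
   (2 * (#|J2| * D2)).+1 ^ #|I| <= _)%N.
  apply: leq_sum => _ /imsetP[s1 _ ->].
  exact: leq_trans (leq_imset_card _ _) (A2P s1).
rewrite sum_nat_const leq_mul2r; apply/orP; right.
exact: leq_trans (leq_imset_card _ _) A1P.
Qed.

Section Network.
Variables (sigma : R -> R) (e D L : nat) (phi : R -> 'I_e -> R).
Hypothesis sigmaP : @poly_repr R sigma e D L phi.
Variables (p m d : nat).
Hypothesis p_gt0 : (0 < p)%N.
Local Notation Z := {ffun 'I_m -> 'I_p}.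

Let label (s : Z) : 'I_p := Ordinal (ltn_pmod (\sum_(i < m) (s i : nat)) p_gt0).

Let correct W V (s : Z) := [forall k : 'I_p, (k != label s) ==>
  (@scores R sigma d p W V (featX R s) k ord0 <
   scores sigma W V (featX R s) (label s) ord0)].

(** A strict maximizer is unique, so [pick] finds the label exactly when the label beats every other
    class. *)
Lemma err01E W V s : err01 sigma W V s = (~~ correct W V s)%:R.
Proof.
rewrite /err01 /predictor.
have [corr|ncorr] /= := boolP (correct W V s).
  case: pickP => [l /forallP lP|/(_ (label s))]; last by rewrite -/(correct W V s) corr.
  rewrite (_ : l = label s) ?eqxx//; apply/eqP/negPn/negP => nl.
  have := lP (label s); rewrite eq_sym nl /= => lt1.
  have := forallP corr l; rewrite nl /= => lt2.
  by have := lt_trans lt1 lt2; rewrite ltxx.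
case: pickP => [l lP /=|//]; case: eqP => // -[] ll; case/negP: ncorr.
have {}ll : label s = l by apply/val_inj.
by rewrite /correct ll.
Qed.

Let count (s : Z) (r : 'I_p) := (\sum_(i < m) (s i == r))%N.

Let count_sum s : (\sum_r count s r <= m)%N.
Proof.
rewrite exchange_big /= -[leqRHS]card_ord -sum1_card; apply: leq_sum => i _.
rewrite (bigD1 (s i))//= eqxx big1// => r.
by rewrite eq_sym => /negbTE ->.
Qed.

Let scoresE W V s c : @scores R sigma d p W V (featX R s) c ord0 =
  \sum_j V c j * sigma (\sum_r W j r * (count s r)%:R).
Proof.
rewrite !mxE; apply: eq_bigr => j _; rewrite !mxE; congr (_ * sigma _).
apply: eq_bigr => r _; congr (_ * _); rewrite summxE natr_sum.
by apply: eq_bigr => i _; rewrite !mxE andbT eq_sym.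
Qed.

Definition loss (W : 'M[R]_(d, p)) (V : 'M[R]_(p, d)) : {ffun Z -> bool} :=
  [ffun s => ~~ correct W V s].

Definition losses : {set {ffun Z -> bool}} :=
  [set f | `[< exists W V, f = loss W V >]].

(** The first stage decides the polynomial pieces of all neurons on all inputs. The second takes the
    signs of score differences after clearing denominators: degree 1 from [V], then one numerator
    and up to [d] denominators. *)
Lemma card_traces_losses (K : finType) (T : {ffun K -> Z}) :
  (#|traces losses T| <=
   ((2 * (#|K| * d * L * (D * m.+1))).+1 *
    (2 * (#|K| * p * (1 + (D * m.+1 + d * (D * m.+1))))).+1) ^
      (d * (p * e) + p * d))%N.
Proof.
have /choice[f1] k := sigmaP (count_sum (T k)).
move=> /choice[N] /choice[Q] HP.
pose I : finType := (('I_d * ('I_p * 'I_e)) + ('I_p * 'I_d))%type.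
pose param (W : 'M[R]_(d, p)) (V : 'M[R]_(p, d)) : I -> R := fun i => match i with
  | inl (j, (r, i)) => phi (W j r) i | inr (c, j) => V c j end.
pose neuron (x : I -> R) j : 'I_p * 'I_e -> R := x \o (fun i => inl (j, i)).
pose F1 (t : K * 'I_d * 'I_L) (x : I -> R) := f1 t.1.1 t.2 (neuron x t.1.2).
pose F2 (s : {ffun K * 'I_d * 'I_L -> bool}) (t : K * 'I_p) (x : I -> R) :=
  \sum_j (x (inr (label (T t.1), j)) - x (inr (t.2, j))) *
    (N t.1 [ffun l => s (t.1, j, l)] (neuron x j) *
     \prod_(j' | j' != j) Q t.1 (neuron x j')).
pose dec (s : {ffun K * 'I_p -> bool}) := [ffun k =>
  ~~ [forall c, (c != label (T k)) ==> s (k, c)]].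
have := @card_two_stage I _ _ _ (D * m.+1) (1 + (D * m.+1 + d * (D * m.+1)))
  F1 F2 dec (traces losses T).
rewrite expnMn !card_prod !card_ord card_sum !card_prod !card_ord; apply.
- move=> t; have [TP _ _ _] := HP t.1.1.
  exact: polyfun_reindex (TP t.2).
- move=> s t; have [_ NP QP _] := HP t.1.
  apply: polyfun_sum => j _; apply: polyfun_mul.
    by apply: polyfunB; exact: polyfun_var.
  apply: polyfun_mul; first exact: polyfun_reindex (NP _).
  rewrite -[X in polyfun (X * _)](card_ord d); apply: polyfun_prod => j' _.
  exact: polyfun_reindex QP.
move=> _ /imsetP[f + ->]; rewrite inE => /asboolP[W [V ->]].
exists (param W V).
set x := (X in dec X); apply/ffunP => k; rewrite !ffunE /correct; congr (~~ _).
apply: eq_forallb => c; congr (_ ==> _); rewrite /x ffunE /F2 /=.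
pose u j := neuron (param W V) j.
have {HP}[_ _ _ HP] := HP k.
have uE j : u j = (fun i => phi (W j i.1) i.2) by apply/funext => -[].
have Q0 j : 0 < Q k (u j) by rewrite uE; have [] := HP (W j).
have NE j : N k [ffun l => [ffun i => 0 < F1 i (param W V)] (k, j, l)] (u j) = 
  sigma (\sum_r W j r * (count (T k) r)%:R) * Q k (u j).
  have [_] := HP (W j); rewrite -uE => ->; congr (N k _ _).
  by apply/ffunP => l; rewrite !ffunE.
(* Each numerator equals the activation times its own denominator, so the product of all [Q] comes
   out as one positive factor that leaves the sign unchanged. *)
under [X in _ = (0 < X)]eq_bigr => j _.
  rewrite NE -mulrA -(bigD1 j (P := xpredT) (F := fun j => Q k (u j)))//= mulrA.
  over.
rewrite -big_distrl pmulr_lgt0 ?prodr_gt0// !scoresE -subr_gt0 -sumrB.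
by congr (0 < _); apply: eq_bigr => j _; rewrite mulrBl.
Qed.

End Network.
End Growth.

(** * Numerical estimates and the final bound *)

(** The two factors are constants times [H ^ 3] and [H ^ 4], whence the 7, and the number of
    parameters is [(e + 1) * (d * p)]. *)
Lemma trace_bound_poly (p m d n e D L : nat) :
  (0 < p)%N -> (0 < m)%N -> (0 < d)%N -> (0 < n)%N ->
  (((2 * (n * 2 * d * L * (D * m.+1))).+1 *
    (2 * (n * 2 * p * (1 + (D * m.+1 + d * (D * m.+1))))).+1) ^
      (d * (p * e) + p * d) <=
   (2 + d + p + m + n) ^
     (((4 * L * D + 1) * (8 * D + 5) + 7) * (e + 1) * (d * p)))%N.
Proof.
move=> p0 m0 d0 n0; set H := (2 + d + p + m + n)%N.
set c := ((4 * L * D + 1) * (8 * D + 5))%N.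
have dH : (d <= H)%N by lia.
have pH : (p <= H)%N by lia.
have mH : (m.+1 <= H)%N by lia.
have nH : (n <= H)%N by lia.
have H0 : (0 < H)%N by lia.
have b1 : ((2 * (n * 2 * d * L * (D * m.+1))).+1 <= (4 * L * D + 1) * H ^ 3)%N.
  have : (n * d * m.+1 <= H ^ 3)%N by rewrite !expnS expn0 muln1 mulnA !leq_mul.
  have : (0 < H ^ 3)%N by rewrite expn_gt0 H0.
  by move: (H ^ 3)%N => h h0 nh; rewrite mulnDl -addn1 leq_add//; nia.
have b2 : ((2 * (n * 2 * p * (1 + (D * m.+1 + d * (D * m.+1))))).+1 <=
    (8 * D + 5) * H ^ 4)%N.
  have h1 : (1 <= H ^ 2)%N by rewrite expn_gt0 H0.
  have h2 : (D * m.+1 <= D * H ^ 2)%N.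
    by rewrite leq_mul// (leq_trans mH)// expnS expn1 leq_pmulr.
  have h3 : (d * (D * m.+1) <= D * H ^ 2)%N.
    by rewrite mulnCA leq_mul// expnS expn1 leq_mul.
  have h4 : (1 + (D * m.+1 + d * (D * m.+1)) <= (2 * D + 1) * H ^ 2)%N.
    by apply: leq_trans (leq_add h1 (leq_add h2 h3)) _; nia.
  have h5 : (n * p <= H ^ 2)%N by rewrite expnS expn1 leq_mul.
  have h6 := leq_mul h5 h4.
  have h7 : (H ^ 4 = H ^ 2 * H ^ 2)%N by rewrite -expnD.
  rewrite h7; move: h1 h6; move: (H ^ 2)%N (1 + _)%N => h s h1 h6.
  by nia.
(* Since [H >= 2], a constant depending on the activation is absorbed into a power of [H]. *)
have cH : (c <= H ^ c)%N.
  by apply: leq_trans (ltnW (ltn_expl c (isT : 1 < 2)%N)) _; rewrite leq_exp2r; lia.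
have B : ((2 * (n * 2 * d * L * (D * m.+1))).+1 *
    (2 * (n * 2 * p * (1 + (D * m.+1 + d * (D * m.+1))))).+1 <= H ^ (c + 7))%N.
  apply: leq_trans (leq_mul b1 b2) _; rewrite mulnACA -expnD (expnD H c 7).
  by rewrite leq_mul.
apply: (@leq_trans ((H ^ (c + 7)) ^ (d * (p * e) + p * d))).
  by rewrite leq_exp2r//; lia.
by rewrite -expnM leq_eqVlt; apply/orP; left; apply/eqP; congr expn; ring.
Qed.

(** [C] and [k] are chosen before the sizes and [delta], so they depend on the activation alone, as
    the soft O requires; one power of the logarithm suffices. *)
Theorem mainTheorem5 (R : realType) (sigma : R -> R) :
  activation_family sigma ->
  exists (C : R) (k : nat), forall (p m d n : nat) (delta : R),
    (2 <= p)%N -> (1 <= m)%N -> (1 <= d)%N -> (1 <= n)%N -> 0 < delta < 1 ->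
    1 - delta <=
    @prob_train R p m n (fun S => forall (W : 'M[R]_(d, p)) (V : 'M[R]_(p, d)),
       `| pop_risk sigma m W V - emp_risk sigma W V S |
         <= C * ln (2 + d%:R + p%:R + m%:R + n%:R + delta^-1) ^+ k
              * Num.sqrt (((d * p)%:R + ln delta^-1) / n%:R)).
Proof.
move=> /activation_repr[e [D [L [phi sigmaP]]]].
set c := (((4 * L * D + 1) * (8 * D + 5) + 7) * (e + 1))%N.
(* With this constant, [n * eps ^+ 2 / 8] becomes [2 * (c + 2) ^+ 2 * l ^+ 2 * (d * p + t)]. *)
exists (4 * (c%:R + 2)), 1%N => p m d n delta p2 m1 d1 n1 /andP[delta0 delta1].
have p0 : (0 < p)%N by apply: leq_trans p2.
set H := (2 + d + p + m + n)%N.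
set Lam := 2 + d%:R + p%:R + m%:R + n%:R + delta^-1.
set t := ln delta^-1; set l := ln Lam.
have HLam : H%:R <= Lam by rewrite /Lam -!natrD lerDl invr_ge0 ltW.
have H0 : (0 : R) < H%:R by rewrite ltr0n.
have Lam0 : 0 < Lam by apply: lt_le_trans HLam.
have t0 : 0 <= t by rewrite ln_ge0// invf_ge1// ltW.
(* This crude bound, from [Lam >= 2], lets [l ^+ 2] dominate both [l / 2] and the constant
   [1 / 4]. *)
have l_ge : 1 / 2 <= l.
  have := expR_ge1Dx (- l); rewrite expRN lnK ?posrE// => e1.
  have e2 : Lam^-1 <= 2^-1.
    by rewrite lef_pV2 ?posrE//; apply: le_trans HLam; rewrite ler_nat.
  lra.
set eps := _ * _ * Num.sqrt _.
have n0 : (0 : R) < n%:R by rewrite ltr0n.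
have dp1 : (1 : R) <= (d * p)%:R by rewrite (ler_nat _ 1) muln_gt0 d1.
have arg0 : 0 <= ((d * p)%:R + t) / n%:R by rewrite divr_ge0 ?addr_ge0 ?ler0n// ltW.
have c0 : (0 : R) <= c%:R by [].
have eps0 : 0 <= eps.
  by rewrite /eps !mulr_ge0 ?sqrtr_ge0 ?exprn_ge0//; lra.
pose M := {ffun 'I_n -> {ffun 'I_m -> 'I_p}}.
have M0 : (0 : R) < #|{: M}|%:R.
  by rewrite ltr0n !card_ffun !card_ord !expn_gt0 p0.
set F := losses sigma m d p0.
set N := (H ^ (c * (d * p)))%N.
have traceN (T : {ffun 'I_n * bool -> {ffun 'I_m -> 'I_p}}) : (#|traces F T| <= N)%N.
  apply: leq_trans (card_traces_losses sigmaP d p0 T) _.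
  rewrite card_prod card_bool card_ord; exact: trace_bound_poly.
set good := fun S => _.
pose Bad := [set S : M | [exists f in F, eps < `|risk R f - emp R f S|]].
have Bad_le : #|Bad|%:R <= #|{: M}|%:R * delta.
  apply: le_trans (uniform_deviation n1 eps0 traceN) _.
  rewrite ler_pM2l//.
  have N0 : (0 : R) < N%:R by rewrite ltr0n expn_gt0.
  (* In logarithms, the goal is that [n * eps ^+ 2 / 8] is at least [ln 2 + ln N + t]. *)
  rewrite -[leRHS]lnK ?posrE// -[2 * _]lnK ?posrE ?mulr_gt0// -expRD ler_expR.
  have -> : ln delta = - t by rewrite /t lnV ?posrE// opprK.
  rewrite lnM ?posrE//.
  have ln2 : ln 2 <= 1 :> R by apply: le_trans (le_ln1Dx _) _; lra.
  have lnN : ln N%:R <= c%:R * (d * p)%:R * l.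
    rewrite /N natrX lnXn// -[leLHS]mulr_natl natrM ler_wpM2l ?mulr_ge0//.
    by rewrite ler_ln.
  have -> : n%:R * eps ^+ 2 / 8 =
      2 * (c%:R + 2) ^+ 2 * l ^+ 2 * ((d * p)%:R + t).
    rewrite /eps expr1 exprMn sqr_sqrtr//; field.
    by rewrite gt_eqF.
  have l2 : l / 2 <= l ^+ 2 by rewrite expr2; nra.
  (* In the term with [d * p], the summand [c] pays for [ln N] and the summand 4 for [ln 2]; the
     term with [t] pays for [t]. *)
  have c2 : c%:R + 4 <= (c%:R + 2) ^+ 2 :> R by rewrite expr2; nra.
  move: lnN c0 c2 dp1; set X := (_ + 2) ^+ 2.
  set dp := (d * p)%:R; set lN := ln N%:R; move: (c%:R : R) X dp lN.
  move=> a X dp lN lnN a0 aX dp1.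
  have l24 : 1 / 4 <= l ^+ 2 by rewrite expr2; nra.
  have tX : t <= 2 * X * l ^+ 2 * t by rewrite ler_peMl//; nra.
  have dX : X * l * dp <= 2 * X * l ^+ 2 * dp.
    by rewrite ler_wpM2r//; [lra|nra].
  have cX : (a + 4) * (l * dp) <= X * l * dp.
    by rewrite -mulrA ler_wpM2r//; nra.
  have dpl : 1 / 2 <= l * dp by nra.
  lra.
have goodE : #|[set S | `[< good S >]]|%:R =
    #|{: M}|%:R - #|~: [set S | `[< good S >]]|%:R :> R.
  by rewrite -(cardsC [set S | `[< good S >]]) natrD addrK.
rewrite /prob_train goodE mulrBl divff ?gt_eqF// lerB// ler_pdivrMr// mulrC.
apply: le_trans Bad_le; rewrite ler_nat; apply: subset_leq_card.
apply/fintype.subsetP => S; rewrite !inE => /asboolPn.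
move=> /existsNP[W /existsNP[V /negP]]; rewrite -ltNge => bad.
apply/existsP; exists (loss sigma m p0 W V); apply/andP; split.
  by rewrite inE; apply/asboolP; exists W, V.
suff [-> ->] : risk R (loss sigma m p0 W V) = pop_risk sigma m W V /\
    emp R (loss sigma m p0 W V) S = emp_risk sigma W V S by [].
split; congr (_ * _); apply: eq_bigr => s _; by rewrite ffunE err01E.
Qed.
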